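(* Fix $\theta\in(1/2,7/8]$, an interval $[\underline h,\bar h]\subset(0,1)$, $h_1\in[0,1]$, $\alpha\in[0,1]$. Assume that for every realization of the disorder and every $h_0\in[\underline h,\bar h]$, $\langle\sigma_i\sigma_j\rangle_{h_0,h_1,\alpha}-\langle\sigma_i\rangle_{h_0,h_1,\alpha}\langle\sigma_j\rangle_{h_0,h_1,\alpha}\ge 0$ for all $i,j$. Assume the couplings satisfy the condition that $(J_X)$ are independent with finite second moments and $\sum_{X\subset\{1,\dots,n\}}\mathrm{Var}(J_X)\le Cn$ for a constant $C$ independent of $n$, and let $C_P>0$ be a constant independent of $n,h_0,h_1,\alpha$ such that $\mathbb E[(P_n(h_0,h_1,\alpha)-p_n(h_0,h_1,\alpha))^2]\le C_P/n$ for all $h_0,h_1,\alpha\in[0,1]$. Then for all sufficiently large $n$, $$\int_{\underline h}^{\bar h}dh_0\,\mathbb E\big\langle\big(Q_1-\mathbb E\langle Q_1\rangle_{h_0,h_1,\alpha}\big)^2\big\rangle_{h_0,h_1,\alpha}\le\frac{5C_P+42}{n^{1/3}}.$$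
   Context: Spins $\boldsymbol\sigma\in\{-1,1\}^n$, $\sigma_X=\prod_{i\in X}\sigma_i$. The couplings $J_X\ge 0$, $X\subset\{1,\dots,n\}$, are independent random variables; $\tau_1,\dots,\tau_n$ are i.i.d. Poisson with mean $\alpha n^{\theta-1}$, independent of the couplings. Hamiltonian $\mathcal H(\boldsymbol\sigma)=-\sum_XJ_X\sigma_X-h_0\sum_i\sigma_i-h_1\sum_i\tau_i\sigma_i$, partition function $\mathcal Z_{h_0,h_1,\alpha}=\sum_{\boldsymbol\sigma}e^{-\mathcal H}$, Gibbs expectation $\langle\cdot\rangle_{h_0,h_1,\alpha}$ (for several replicas, the product Gibbs measure of independent copies). Pressure $P_n(h_0,h_1,\alpha)=\frac1n\ln\mathcal Z_{h_0,h_1,\alpha}$, $p_n=\mathbb EP_n$, where $\mathbb E$ is expectation over all couplings $J_X$ and over $\boldsymbol\tau$. Overlap $Q_1=\frac1n\sum_i\sigma_i$. *)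

(* Defs.v *)
From HB Require Import structures.
From mathcomp Require Import all_boot all_order all_algebra.
From mathcomp Require Import all_classical all_reals all_analysis.
Set Implicit Arguments. Unset Strict Implicit. Unset Printing Implicit Defensive.
Import Order.TTheory GRing.Theory Num.Theory.
Local Open Scope classical_set_scope.
Local Open Scope ring_scope.

(* Poisson pmf with mean lam >= 0 (lam = 0 gives the Dirac mass at 0). *)
Definition poissonP {R : realType} (lam : R) (k : nat) : R :=
  expR (- lam) * lam ^+ k / k`!%:R.

Definition mutually_independent {d} {Omega : measurableType d} {R : realType}
  (P : probability Omega R) (I : finType) (Y : I -> Omega -> R) : Prop :=
  forall B : I -> set R, (forall i, measurable (B i)) ->
    fine (P (\bigcap_(i in [set: I]) (Y i @^-1` B i))) =
    \prod_(i : I) fine (P (Y i @^-1` B i)).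

Definition var_real {d} {Omega : measurableType d} {R : realType}
  (P : probability Omega R) (Y : Omega -> R) : R :=
  Rintegral P setT (fun w => (Y w - Rintegral P setT Y) ^+ 2).

Section Ising.
Variables (R : realType) (n : nat).

Definition config := {ffun 'I_n -> bool}.
Definition spin (b : bool) : R := if b then 1 else -1.
Definition sigmaX (s : config) (X : {set 'I_n}) : R := \prod_(i in X) spin (s i).

Definition hamiltonian (J : {set 'I_n} -> R) (tau : 'I_n -> R) (h0 h1 : R)
  (s : config) : R :=
  - (\sum_(X : {set 'I_n}) J X * sigmaX s X)
  - h0 * (\sum_(i < n) spin (s i))
  - h1 * (\sum_(i < n) tau i * spin (s i)).

Definition Zpart J tau h0 h1 : R :=
  \sum_(s : config) expR (- hamiltonian J tau h0 h1 s).

Definition gibbs J tau h0 h1 (f : config -> R) : R :=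
  (\sum_(s : config) f s * expR (- hamiltonian J tau h0 h1 s)) / Zpart J tau h0 h1.

Definition pressure J tau h0 h1 : R := ln (Zpart J tau h0 h1) / n%:R.

Definition Q1 (s : config) : R := (\sum_(i < n) spin (s i)) / n%:R.

End Ising.

(* Main.v *)
(** Write [L h] for the pressure, [A h] = <Q1> and [V h] for the thermal variance of
    Q1 at field [h], so that [L' = A] and [A' = n V] for each disorder, and let [q = E A].
    Then E <(Q1 - q)^2> = E V + E (A - q)^2.  Since [L] is convex, [A h] lies between the
    difference quotients of [L] over [h - e, h] and [h, h + e]; comparing them with those
    of [E L] gives
      (A h - q h)^2 <= 4/e^2 (X(h+e)^2 + 2 X(h)^2 + X(h-e)^2) + 4 (q(h+e) - q(h-e)),
    where [X = L - E L].  By concentration the first term has mean at most 16 CP/(n e^2).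
    The remaining terms E V + 4 (q(h+e) - q(h-e)) are integrated over [h] after exchanging
    the integrals: for fixed disorder the primitive is A/n + 4 (L(h+e) - L(h-e)), whose
    increment is at most 2/n + 16 e because |A| <= 1.  Take e = 2 n^(-1/3). *)
Require Import Defs.
From HB Require Import structures.
From mathcomp Require Import all_boot all_order all_algebra.
From mathcomp Require Import all_classical all_reals all_analysis.
From mathcomp Require Import measurable_realfun ring lra.
Set Implicit Arguments. Unset Strict Implicit. Unset Printing Implicit Defensive.
Import Order.TTheory GRing.Theory Num.Theory.
Import numFieldNormedType.Exports.
Local Open Scope classical_set_scope.
Local Open Scope ring_scope.

(** * Comparison of integrals and the deterministic fluctuation inequality *)

(** The integral of a nonnegative function is a supremum over the simple functions below it, and
    those below [f] are also below [g]. It is applied to inner integrals whose measurability in the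
    outer variable is left open. *)
Lemma ge0_le_integral_nonmeasurable d (T : measurableType d) (R : realType)
    (mu : {measure set T -> \bar R}) (D : set T) (f g : T -> \bar R) :
  (forall x, D x -> (0 <= f x)%E) -> (forall x, D x -> (f x <= g x)%E) ->
  (\int[mu]_(x in D) f x <= \int[mu]_(x in D) g x)%E.
Proof.
move=> f0 fg; rewrite integral_mkcond [leRHS]integral_mkcond.
have g0 x : D x -> (0 <= g x)%E by move=> Dx; rewrite (le_trans (f0 x Dx))// fg.
rewrite !ge0_integralTE; [|exact: erestrict_ge0|exact: erestrict_ge0].
apply: le_ereal_sup => _ [h hf <-]; exists h => // x.
apply: (le_trans (hf x)); rewrite !patchE; case: ifPn => //.
by rewrite inE; apply: fg.
Qed.

(** The supporting lines squeeze [A - q] between [v - c] and [u + c], where [u] and [v] are the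
    forward and backward difference quotients of the fluctuation [L - p], and [c = qp - qm]. *)
Lemma sqr_fluctuation_le (R : realFieldType)
    (d A q qm qp Lm L0 Lp pm p0 pp : R) :
  0 < d -> qm <= q <= qp -> qp - qm <= 2 ->
  d * A <= Lp - L0 -> - d * A <= Lm - L0 ->
  - d * qp <= p0 - pp -> d * qm <= p0 - pm ->
  (A - q) ^+ 2 <= 4 / d ^+ 2 *
     ((Lp - pp) ^+ 2 + 2 * (L0 - p0) ^+ 2 + (Lm - pm) ^+ 2) + 4 * (qp - qm).
Proof.
move=> d0 /andP[qmq qqp] q2 LA1 LA2 pq1 pq2.
set u := (Lp - pp - (L0 - p0)) / d; set v := (L0 - p0 - (Lm - pm)) / d.
have ud : u * d = Lp - pp - (L0 - p0) by rewrite /u mulfVK// gt_eqF.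
have vd : v * d = L0 - p0 - (Lm - pm) by rewrite /v mulfVK// gt_eqF.
have dqm : d * qm <= d * q by rewrite ler_pM2l.
have dqp : d * q <= d * qp by rewrite ler_pM2l.
have Au : A - q <= u + (qp - qm).
  by rewrite -(ler_pM2r d0) !mulrDl ud; lra.
have vA : v - (qp - qm) <= A - q.
  by rewrite -(ler_pM2r d0) !mulrDl vd; lra.
have {LA1 LA2 pq1 pq2} : (A - q) ^+ 2 <= 2 * (u ^+ 2 + v ^+ 2) + 4 * (qp - qm).
  move: Au vA; set c := qp - qm; set y := A - q => yu vy.
  (* Since [0 <= c <= 2], the square of [c] can be traded for [c] itself, which has an explicit
     primitive in the field. *)
  have c2 : c ^+ 2 <= 2 * c by rewrite expr2 ler_wpM2r// subr_ge0; lra.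
  have := sqr_ge0 u; have := sqr_ge0 v.
  have := sqr_ge0 (u - c); have := sqr_ge0 (v + c).
  have [y0|y0] := leP 0 y.
    have : y ^+ 2 <= (u + c) ^+ 2 by rewrite ler_sqr ?nnegrE//; lra.
    by rewrite !expr2; nra.
  have : (- y) ^+ 2 <= (c - v) ^+ 2 by rewrite ler_sqr ?nnegrE//; lra.
  by rewrite !expr2; nra.
move=> /le_trans; apply; rewrite lerD2r.
rewrite -(ler_pM2r (exprn_gt0 2 d0)).
have -> : forall x, 4 / d ^+ 2 * x * d ^+ 2 = 4 * x.
  by move=> x; field; rewrite gt_eqF.
have -> : 2 * (u ^+ 2 + v ^+ 2) * d ^+ 2 = 2 * ((u * d) ^+ 2 + (v * d) ^+ 2) by ring.
rewrite ud vd.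
set x := Lp - pp; set y := L0 - p0; set z := Lm - pm.
(* These squares are the gaps in [(x - y)^2 <= 2 x^2 + 2 y^2] and in its analogue for [y - z]. *)
have := sqr_ge0 (x + y); have := sqr_ge0 (y + z); nra.
Qed.

(** * Integrability on a probability space *)

Section probability_integrals.
Context d (T : measurableType d) (R : realType) (P : probability T R).

Lemma bounded_integrable (f : T -> R) (M : R) :
  measurable_fun setT f -> (forall w, `|f w| <= M) ->
  P.-integrable setT (EFin \o f).
Proof.
move=> mf fM; apply: measurable_bounded_integrable => //.
  by apply: le_lt_trans (probability_le1 P measurableT) _; rewrite ltry.
exists M; split; first exact: num_real.
by move=> x Mx w _; apply: le_trans (fM w) (ltW Mx).
Qed.

Lemma integrable_cst (c : R) : P.-integrable setT (EFin \o (fun=> c)).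
Proof. by apply: (@bounded_integrable _ `|c|) => //; exact: measurable_cst. Qed.

Lemma Rintegral_probability_cst (c : R) : Rintegral P setT (fun=> c) = c.
Proof. by rewrite Rintegral_cst//= probability_setT mulr1. Qed.

Lemma integral_EFinE (f : T -> R) : P.-integrable setT (EFin \o f) ->
  (\int[P]_w (f w)%:E)%E = (Rintegral P setT f)%:E.
Proof. by move=> fi; rewrite /Rintegral fineK//; exact: integrable_fin_num. Qed.

Lemma sqr_integrable (f : T -> R) (c : R) :
  measurable_fun setT f -> (\int[P]_w (f w ^+ 2)%:E <= c%:E)%E ->
  P.-integrable setT (EFin \o (fun w => f w ^+ 2)).
Proof.
move=> mf fc; apply/integrableP; split.
  by apply/measurable_EFinP; exact: measurable_funX.
apply: le_lt_trans (ltry c); apply: le_trans fc.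
by under eq_integral do rewrite /= ger0_norm ?sqr_ge0//.
Qed.

(** Domination by [1 + f^2], where the constant is integrable because the total mass is one. *)
Lemma L2_integrable (f : T -> R) (c : R) :
  measurable_fun setT f -> (\int[P]_w (f w ^+ 2)%:E <= c%:E)%E ->
  P.-integrable setT (EFin \o f).
Proof.
move=> mf /(sqr_integrable mf) f2.
have := integrableD measurableT (integrable_cst 1) f2.
apply: le_integrable => //; first exact/measurable_EFinP.
move=> w _ /=; rewrite lee_fin [leRHS]ger0_norm; last first.
  by rewrite addr_ge0// sqr_ge0.
rewrite -[f w ^+ 2]real_normK ?num_real//.
by have := sqr_ge0 (`|f w| - 1); have := normr_ge0 (f w); nra.
Qed.

End probability_integrals.

(** * Fluctuations of the slope of a random convex function *)

Section convex_random_function.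
Context (R : realType) d (Omega : measurableType d) (P : probability Omega R).
Variables (L A V : R -> Omega -> R) (N CP : R).
Hypotheses (N0 : 0 < N) (CP0 : 0 < CP).
Hypothesis mL : forall h, measurable_fun setT (L h).
Hypothesis mA : measurable_fun setT (fun z : R * Omega => A z.1 z.2).
Hypothesis mV : measurable_fun setT (fun z : R * Omega => V z.1 z.2).
Hypothesis A1 : forall h w, `|A h w| <= 1.
Hypothesis V0 : forall h w, 0 <= V h w.
(** Convexity of [L] as a supporting line of slope [A h w]; increments [t] of both signs are
    used. *)
Hypothesis LA : forall h t w, t * A h w <= L (h + t) w - L h w.
Hypothesis dL : forall h w, is_derive h (1 : R) (L ^~ w) (A h w).
Hypothesis dA : forall h w, is_derive h (1 : R) (A ^~ w) (N * V h w).
Hypothesis cV : forall w, continuous (V ^~ w).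
Hypothesis conc : forall h, 0 <= h <= 1 ->
  (\int[P]_w ((L h w - Rintegral P setT (L h)) ^+ 2)%:E <= (CP / N)%:E)%E.

Let q h := Rintegral P setT (A h).
Let p h := Rintegral P setT (L h).

Let mA1 h : measurable_fun setT (A h).
Proof. exact: (measurable_fun_pair2 _ mA). Qed.

Let iA h : P.-integrable setT (EFin \o A h).
Proof. exact: (@bounded_integrable _ _ _ _ _ 1). Qed.

Let mX h : measurable_fun setT (fun w => L h w - p h).
Proof. by apply: measurable_funB => //; exact: measurable_cst. Qed.

(** Concentration makes [L h - p h] square integrable, hence integrable, and the constant is then
    added back. There is no circularity: [Rintegral] applies [fine], so [p h] is a real number from
    the start. *)
Let iL h : 0 <= h <= 1 -> P.-integrable setT (EFin \o L h).
Proof.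
move=> /conc/(@L2_integrable _ _ _ P _ _ (mX h)) iX.
have := integrableD measurableT iX (integrable_cst P (p h)).
by apply: eq_integrable => // w _ /=; rewrite -EFinD subrK.
Qed.

Let iX2 h : 0 <= h <= 1 ->
  P.-integrable setT (EFin \o (fun w => (L h w - p h) ^+ 2)).
Proof. by move=> /conc/(@sqr_integrable _ _ _ P _ _ (mX h)). Qed.

Let X2le h : 0 <= h <= 1 ->
  Rintegral P setT (fun w => (L h w - p h) ^+ 2) <= CP / N.
Proof. by move=> h01; rewrite -lee_fin -integral_EFinE ?conc//; exact: iX2. Qed.

Let A_homo w : {homo A ^~ w : x y / x <= y}.
Proof.
move=> x y; rewrite le_eqVlt => /predU1P[->//|xy].
(* The supporting lines at [x] and at [y] add up to [(y - x) * (A x w - A y w) <= 0]. *)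
have := LA x (y - x) w; have := LA y (x - y) w.
rewrite !subrKC => h1 h2.
have yx : 0 < y - x by rewrite subr_gt0.
by rewrite -(ler_pM2l yx); lra.
Qed.

Let q_homo : {homo q : x y / x <= y}.
Proof. by move=> x y xy; apply: le_Rintegral => // w _; exact: A_homo. Qed.

Let q_bound h : `|q h| <= 1.
Proof.
rewrite ler_norml; apply/andP; split.
  rewrite -[leLHS](Rintegral_probability_cst P); apply: le_Rintegral => //.
    exact: integrable_cst.
  by move=> w _; have := A1 h w; rewrite ler_norml => /andP[].
rewrite -[leRHS](Rintegral_probability_cst P); apply: le_Rintegral => //.
  exact: integrable_cst.
by move=> w _; have := A1 h w; rewrite ler_norml => /andP[].
Qed.

(** Averaging the supporting lines of [L] makes [q] a slope of [p] without differentiating under the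
    expectation. *)
Let pq h t : 0 <= h <= 1 -> 0 <= h + t <= 1 -> t * q h <= p (h + t) - p h.
Proof.
move=> h01 ht01; rewrite -RintegralB//; [|exact: iL..].
rewrite -RintegralZl//; apply: le_Rintegral => //.
- exact: (integrableZl measurableT t (iA h)).
- exact: (integrableB measurableT (iL _) (iL _)).
Qed.

(** Expectation of [sqr_fluctuation_le]: the second moments at [h + e], [h], [h - e] carry weights
    1, 2, 1 and are each at most [CP / N]. The conditions on [e] keep the three fields in [0, 1],
    where concentration holds. *)
Let variance_le h e : 0 < e -> 0 <= h - e -> h + e <= 1 ->
  Rintegral P setT (fun w => (A h w - q h) ^+ 2) <=
  16 * CP / (N * e ^+ 2) + 4 * (q (h + e) - q (h - e)).
Proof.
move=> e0 he0 he1.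
have hm01 : 0 <= h - e <= 1 by apply/andP; split; lra.
have h01 : 0 <= h <= 1 by apply/andP; split; lra.
have hp01 : 0 <= h + e <= 1 by apply/andP; split; lra.
have k0 : 0 < 4 / e ^+ 2 by rewrite divr_gt0// exprn_gt0.
pose D h w := (L h w - p h) ^+ 2.
have iD g : 0 <= g <= 1 -> P.-integrable setT (EFin \o D g) by exact: iX2.
have iZ (c : R) f : P.-integrable setT (EFin \o f) ->
    P.-integrable setT (EFin \o (fun w => c * f w)).
  by move=> fi; exact: (integrableZl measurableT c fi).
have iS f g : P.-integrable setT (EFin \o f) ->
    P.-integrable setT (EFin \o g) ->
    P.-integrable setT (EFin \o (fun w => f w + g w)).
  by move=> fi gi; exact: (integrableD measurableT fi gi).
have iDD : P.-integrable setT
    (EFin \o (fun w => D (h + e) w + 2 * D h w + D (h - e) w)).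
  exact: (iS _ _ (iS _ _ (iD _ hp01) (iZ 2 _ (iD _ h01))) (iD _ hm01)).
have -> : 16 * CP / (N * e ^+ 2) = 4 / e ^+ 2 * (4 * (CP / N)).
  by field; rewrite !gt_eqF.
apply: (@le_trans _ _ (Rintegral P setT (fun w =>
   4 / e ^+ 2 * (D (h + e) w + 2 * D h w + D (h - e) w)
   + 4 * (q (h + e) - q (h - e))))).
  apply: le_Rintegral => //.
  - apply: (@bounded_integrable _ _ _ _ _ 4).
      by apply: measurable_funX; apply: measurable_funB => //; exact: measurable_cst.
    move=> w; rewrite ger0_norm ?sqr_ge0//.
    have := A1 h w; have := q_bound h; rewrite !ler_norml => /andP[? ?] /andP[? ?].
    nra.
  - exact: (iS _ _ (iZ _ _ iDD) (integrable_cst P _)).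
  - move=> w _; apply: sqr_fluctuation_le => //.
    + by rewrite !q_homo//; lra.
    + have := q_bound (h + e); have := q_bound (h - e).
      by rewrite !ler_norml => /andP[? ?] /andP[? ?]; lra.
    (* For [p] the supporting lines are those at the outer fields [h + e] and [h - e], evaluated at
       [h]. *)
    + have := @pq (h + e) (- e); rewrite addrK; exact.
    + have := @pq (h - e) e; rewrite subrK; exact.
rewrite RintegralD//; [|exact: iZ|exact: integrable_cst].
rewrite Rintegral_probability_cst lerD2r RintegralZl// ler_pM2l//.
rewrite RintegralD//;
  [|exact: (iS _ _ (iD _ hp01) (iZ 2 _ (iD _ h01)))|exact: iD].
rewrite RintegralD//; [|exact: iD|exact: (iZ 2 _ (iD _ h01))].
rewrite RintegralZl//; last exact: iD.
have -> : 4 * (CP / N) = CP / N + 2 * (CP / N) + CP / N by ring.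
by apply: lerD; [apply: lerD|]; rewrite ?ler_pM2l//; exact: X2le.
Qed.

(** The increment of [q] is put back under the expectation as that of [A], so that the right-hand
    integrand depends on the field through one disorder sample only and can be integrated path by
    path. *)
Let fluctuation_le h e : 0 < e -> 0 <= h - e -> h + e <= 1 ->
  (\int[P]_w (V h w + (A h w - q h) ^+ 2)%:E <=
   \int[P]_w (V h w + (16 * CP / (N * e ^+ 2) +
                 4 * (A (h + e) w - A (h - e) w)))%:E)%E.
Proof.
move=> e0 he0 he1.
have AA w : 0 <= A (h + e) w - A (h - e) w.
  by rewrite subr_ge0; apply: A_homo; lra.
have c0 : 0 <= 16 * CP / (N * e ^+ 2).
  by rewrite divr_ge0 ?mulr_ge0 ?sqr_ge0 ?ltW.
have mVh : measurable_fun setT (EFin \o V h).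
  exact/measurable_EFinP/(measurable_fun_pair2 _ mV).
have mAq : measurable_fun setT (fun w => (A h w - q h) ^+ 2).
  by apply: measurable_funX; apply: measurable_funB => //; exact: measurable_cst.
have mAA : measurable_fun setT
    (fun w => 16 * CP / (N * e ^+ 2) + 4 * (A (h + e) w - A (h - e) w)).
  apply: measurable_funD; first exact: measurable_cst.
  by apply: measurable_funM; [exact: measurable_cst|exact: measurable_funB].
under eq_integral do rewrite EFinD.
under [leRHS]eq_integral do rewrite EFinD.
rewrite ge0_integralD//; last 3 first.
- by move=> w _; rewrite lee_fin.
- by move=> w _; rewrite lee_fin sqr_ge0.
- exact/measurable_EFinP.
rewrite ge0_integralD//; last 3 first.
- by move=> w _; rewrite lee_fin.
- by move=> w _; rewrite lee_fin addr_ge0// mulr_ge0.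
- exact/measurable_EFinP.
rewrite leeD2l//.
have iAA : P.-integrable setT (EFin \o (fun w => A (h + e) w - A (h - e) w)).
  exact: (integrableB measurableT (iA _) (iA _)).
rewrite !integral_EFinE ?lee_fin.
- rewrite RintegralD//; first last.
  + exact: (integrableZl measurableT 4 iAA).
  + exact: integrable_cst.
  rewrite Rintegral_probability_cst RintegralZl// RintegralB//.
  exact: variance_le.
- exact: (integrableD measurableT (integrable_cst P _)
    (integrableZl measurableT 4 iAA)).
- apply: (@bounded_integrable _ _ _ _ _ 4) => // w.
  rewrite ger0_norm ?sqr_ge0//.
  have := A1 h w; have := q_bound h; rewrite !ler_norml => /andP[? ?] /andP[? ?].
  nra.
Qed.

Let is_derive_shift (f : R -> R) (h c df : R) :
  is_derive (h + c) (1 : R) f df -> is_derive h (1 : R) (fun x => f (x + c)) df.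
Proof.
move=> fd.
have dc : is_derive h (1 : R) (fun x : R => x + c) 1.
  rewrite -[1 in X in is_derive _ _ _ X]addr0.
  exact: (is_deriveD (is_derive_id _ _) (is_derive_cst _ _ _)).
rewrite -[df]mulr1.
exact: (@is_derive1_comp R f (fun x : R => x + c) h df 1 fd dc).
Qed.

Let is_derive_continuous (f df : R -> R) :
  (forall h, is_derive h (1 : R) f (df h)) -> continuous f.
Proof.
move=> fd h; apply: differentiable_continuous; apply/derivable1_diffP.
exact: ex_derive.
Qed.

(** Fundamental theorem of calculus, the primitive coming from [A' = N V] and [L' = A]. *)
Let integral_pathwise a b e c w : a <= b ->
  (\int[lebesgue_measure]_(h in `[a, b])
      (V h w + (c + 4 * (A (h + e) w - A (h - e) w)))%:E)%E =
  (A b w / N + c * b + 4 * (L (b + e) w - L (b - e) w)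
   - (A a w / N + c * a + 4 * (L (a + e) w - L (a - e) w)))%:E.
Proof.
rewrite le_eqVlt => /predU1P[<-|ab].
  by rewrite set_itv1 integral_set1 subrr.
pose F h := A h w / N + c * h + 4 * (L (h + e) w - L (h - e) w).
pose f h := V h w + (c + 4 * (A (h + e) w - A (h - e) w)).
have dF h : is_derive h (1 : R) F (f h).
  have d1 : is_derive h (1 : R) (fun x => A x w / N) (V h w).
    have := is_deriveM (dA h w) (is_derive_cst (N^-1 : R) h (1 : R)).
    by rewrite scaler0 add0r /GRing.scale/= mulrA mulVf ?gt_eqF// mul1r.
  have d2 : is_derive h (1 : R) (fun x : R => c * x) c.
    have := is_deriveM (is_derive_cst (c : R) h (1 : R)) (is_derive_id h (1 : R)).
    by rewrite scaler0 addr0 /GRing.scale/= mulr1.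
  have d3 : is_derive h (1 : R) (fun x => 4 * (L (x + e) w - L (x - e) w))
      (4 * (A (h + e) w - A (h - e) w)).
    have := is_deriveM (is_derive_cst (4 : R) h (1 : R))
      (is_deriveB (is_derive_shift (dL (h + e) w)) (is_derive_shift (dL (h - e) w))).
    by rewrite scaler0 addr0 /GRing.scale/=.
  by apply: is_derive_eq (is_deriveD (is_deriveD d1 d2) d3) _; rewrite /f addrA.
have cA : continuous (A ^~ w) by exact: (is_derive_continuous (dA ^~ w)).
have cAs t : continuous (fun h => A (h + t) w).
  move=> h; apply: (@continuous_comp _ _ _ (fun x : R => x + t) (A ^~ w)).
    exact: (cvgD cvg_id (cvg_cst _)).
  exact: cA.
have cf : continuous f.
  have c1 : continuous (fun _ : R => c) by move=> h; exact: cvg_cst.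
  have c4 : continuous (fun _ : R => 4 : R) by move=> h; exact: cvg_cst.
  move=> h.
  exact: (continuousD (@cV w h) (continuousD (c1 h) (continuousM (c4 h)
    (continuousB (cAs e h) (cAs (- e) h))))).
have cF : continuous F by exact: (is_derive_continuous dF).
rewrite (@continuous_FTC2 _ f F a b)//.
- exact: continuous_subspaceT.
- split.
  + by move=> x _; apply: ex_derive.
  + exact/cvg_at_right_filter/cF.
  + exact/cvg_at_left_filter/cF.
- by move=> x _; rewrite derive1E; apply: derive_val.
Qed.

Let L_shift_le h t w : `|L (h + t) w - L h w| <= `|t|.
Proof.
have := LA h t w; have := LA (h + t) (- t) w; rewrite addrK.
have := A1 h w; have := A1 (h + t) w.
rewrite !ler_norml => /andP[? ?] /andP[? ?] ? ?.
by have [t0|/ltW t0] := leP 0 t;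
  rewrite ?(ger0_norm t0) ?(ler0_norm t0); apply/andP; split; nra.
Qed.

Lemma integral_fluctuation_le a b e : 0 < e -> 0 <= a - e -> a <= b -> b + e <= 1 ->
  (\int[lebesgue_measure]_(h in `[a, b])
     \int[P]_w (V h w + (A h w - Rintegral P setT (A h)) ^+ 2)%:E <=
   (2 / N + 16 * CP / (N * e ^+ 2) + 16 * e)%:E)%E.
Proof.
move=> e0 ae ab be; set c := 16 * CP / (N * e ^+ 2).
have c0 : 0 <= c by rewrite /c divr_ge0 ?mulr_ge0 ?sqr_ge0 ?ltW.
pose H (z : R * Omega) := V z.1 z.2 + (c + 4 * (A (z.1 + e) z.2 - A (z.1 - e) z.2)).
have H0 z : 0 <= H z.
  rewrite /H addr_ge0// addr_ge0// mulr_ge0// subr_ge0; apply: A_homo; lra.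
have mH : measurable_fun setT H.
  have mshift t : measurable_fun setT (fun z : R * Omega => A (z.1 + t) z.2).
    have ms : measurable_fun setT (fun z : R * Omega => (z.1 + t, z.2)).
      apply: measurable_fun_pair => //=.
      by apply: measurable_funD => //; exact: measurable_cst.
    exact: (measurableT_comp mA ms).
  apply: measurable_funD => //; apply: measurable_funD => //.
  by apply: measurable_funM => //; apply: measurable_funB.
(* The indicator of the field interval lets Tonelli be applied on the whole product space. *)
pose f := (fun z : R * Omega => (H z * \1_(`[a, b] : set R) z.1)%:E).
have mf : measurable_fun setT f.
  apply/measurable_EFinP; apply: measurable_funM => //.
  have mi : measurable_fun setT (\1_(`[a, b] : set R) : R -> R).
    exact: measurable_indic.
  exact: (measurableT_comp mi measurable_fst).
have f0 z : (0 <= f z)%E by rewrite lee_fin mulr_ge0// indic_ge0.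
apply: (@le_trans _ _ (\int[lebesgue_measure]_(h in `[a, b]) \int[P]_w (H (h, w))%:E)%E).
  apply: ge0_le_integral_nonmeasurable => h.
    by move=> _; apply: integral_ge0 => w _; rewrite lee_fin addr_ge0// sqr_ge0.
  rewrite /= in_itv/= => /andP[ah hb].
  by apply: fluctuation_le => //; lra.
have -> : (\int[lebesgue_measure]_(h in `[a, b]) \int[P]_w (H (h, w))%:E =
    \int[lebesgue_measure]_h \int[P]_w f (h, w))%E.
  rewrite integral_mkcond; apply: eq_integral => h _; rewrite patchE.
  case: ifPn => hab; apply/esym.
    by apply: eq_integral => w _; rewrite /f indicE hab mulr1.
  by apply: integral0_eq => w _; rewrite /f indicE (negbTE hab) mulr0.
rewrite fubini_tonelli//.
(* The bound for a single disorder is uniform in [w], so averaging it costs nothing. *)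
apply: (@le_trans _ _ (\int[P]_w (2 / N + c + 16 * e)%:E)%E); last first.
  by rewrite integral_cst//= probability_setT mule1.
apply: ge0_le_integral_nonmeasurable => w _; first exact: integral_ge0.
have -> : (\int[lebesgue_measure]_h f (h, w) =
    \int[lebesgue_measure]_(h in `[a, b]) (H (h, w))%:E)%E.
  rewrite [RHS]integral_mkcond; apply: eq_integral => h _; rewrite patchE.
  by rewrite /f indicE; case: ifPn => _; rewrite ?mulr1 ?mulr0.
rewrite integral_pathwise// lee_fin.
have AN : A b w / N - A a w / N <= 2 / N.
  rewrite -mulrBl ler_pM2r ?invr_gt0//.
  by have := A1 a w; have := A1 b w; rewrite !ler_norml => /andP[? ?] /andP[? ?]; lra.
(* The field interval has length at most 1, both ends lying in [0, 1]. *)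
have cba : c * b - c * a <= c by rewrite -mulrBr ler_piMr//; lra.
(* Four shifts of [L], each of size at most [e] and multiplied by 4, account for [16 * e]. *)
have := L_shift_le b e w; have := L_shift_le b (- e) w.
have := L_shift_le a e w; have := L_shift_le a (- e) w.
rewrite normrN !(ger0_norm (ltW e0)) !ler_norml.
move=> /andP[? ?] /andP[? ?] /andP[? ?] /andP[? ?]; lra.
Qed.

End convex_random_function.

(** * Gibbs averages and their derivatives in the field *)

Lemma is_derive_bigsum (R : realType) (I : finType) (F : I -> R -> R) (dF : I -> R)
    (h : R) : (forall i, is_derive h (1 : R) (F i) (dF i)) ->
  is_derive h (1 : R) (fun x => \sum_i F i x) (\sum_i dF i).
Proof.
move=> dFi.
have -> : (fun x => \sum_i F i x) = \sum_i F i.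
  by apply/funext => x; rewrite fct_sumE.
apply: (big_ind2 (fun (f : R -> R) df => is_derive h (1 : R) f df)) => //.
- exact: is_derive_cst.
- by move=> f df g dg ? ?; exact: is_deriveD.
Qed.

Section gibbs_calculus.
Context (R : realType) (n : nat) (J : {set 'I_n} -> R) (tau : 'I_n -> R) (h1 : R).
Implicit Types (f g : config n -> R) (h t c : R) (s : config n).

Let Z h := Zpart J tau h h1.
Let W h s := expR (- hamiltonian J tau h h1 s).
Let E h f := gibbs J tau h h1 f.

Let ham_shift h t s :
  - hamiltonian J tau (h + t) h1 s =
  - hamiltonian J tau h h1 s + t * \sum_(i < n) spin R (s i).
Proof. by rewrite /hamiltonian; ring. Qed.

Lemma Zpart_gt0 h : 0 < Zpart J tau h h1.
Proof.
rewrite /Zpart (bigD1 [ffun=> true])//= ltr_pwDl ?expR_gt0//.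
by apply: sumr_ge0 => s _; exact: expR_ge0.
Qed.

Let Z_neq0 h : Z h != 0. Proof. by rewrite gt_eqF// Zpart_gt0. Qed.

Lemma gibbsD h f g :
  gibbs J tau h h1 (fun s => f s + g s) = gibbs J tau h h1 f + gibbs J tau h h1 g.
Proof.
rewrite /gibbs -mulrDl -big_split/=; congr (_ / _).
by apply: eq_bigr => s _; rewrite mulrDl.
Qed.

Lemma gibbsZ h c f : gibbs J tau h h1 (fun s => c * f s) = c * gibbs J tau h h1 f.
Proof.
rewrite /gibbs mulrA mulr_sumr; congr (_ / _).
by apply: eq_bigr => s _; rewrite mulrA.
Qed.

Lemma gibbs_cst h c : gibbs J tau h h1 (fun=> c) = c.
Proof. by rewrite /gibbs -mulr_sumr mulfK// Z_neq0. Qed.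

Lemma gibbs_le h f g : (forall s, f s <= g s) ->
  gibbs J tau h h1 f <= gibbs J tau h h1 g.
Proof.
move=> fg; rewrite /gibbs ler_pM2r ?invr_gt0 ?Zpart_gt0//.
by apply: ler_sum => s _; rewrite ler_pM2r ?expR_gt0.
Qed.

(** Splitting a mean square about [c] into variance and squared bias; with [c] the disorder average
    of the magnetization it yields [V] and the square of [A - q]. *)
Lemma gibbs_sqrB h c f :
  gibbs J tau h h1 (fun s => (f s - c) ^+ 2) =
  gibbs J tau h h1 (fun s => f s ^+ 2) - gibbs J tau h h1 f ^+ 2
    + (gibbs J tau h h1 f - c) ^+ 2.
Proof.
have -> : (fun s => (f s - c) ^+ 2) =
    (fun s => f s ^+ 2 + ((- 2 * c) * f s + c ^+ 2)).
  by apply/funext => s; ring.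
by rewrite gibbsD gibbsD gibbsZ gibbs_cst; ring.
Qed.

Lemma gibbs_variance_ge0 h f :
  0 <= gibbs J tau h h1 (fun s => f s ^+ 2) - gibbs J tau h h1 f ^+ 2.
Proof.
have := gibbs_sqrB h (gibbs J tau h h1 f) f; rewrite subrr expr0n addr0 => <-.
by rewrite -[leLHS](gibbs_cst h 0); apply: gibbs_le => s; exact: sqr_ge0.
Qed.

Lemma spin_abs b : `|spin R b| = 1.
Proof. by case: b; rewrite /= ?normrN normr1. Qed.

Lemma Q1_abs s : `|Q1 R s| <= 1.
Proof.
(* For [n = 0] the inverse of zero is zero, hence so is [Q1]. *)
rewrite /Q1; have [n0|n0] := posnP n.
  have -> : n%:R = 0 :> R by rewrite n0.
  by rewrite invr0 mulr0 normr0.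
rewrite normrM normfV (ger0_norm (ler0n _ n)) ler_pdivrMr ?ltr0n// mul1r.
apply: le_trans (ler_norm_sum _ _ _) _.
under eq_bigr do rewrite spin_abs.
by rewrite sumr_const card_ord.
Qed.

Lemma gibbs_Q1_abs h : `|gibbs J tau h h1 (@Q1 R n)| <= 1.
Proof.
rewrite ler_norml; apply/andP; split.
  rewrite -[leLHS](gibbs_cst h); apply: gibbs_le => s.
  by have := Q1_abs s; rewrite ler_norml => /andP[].
rewrite -[leRHS](gibbs_cst h); apply: gibbs_le => s.
by have := Q1_abs s; rewrite ler_norml => /andP[].
Qed.

Hypothesis n0 : (0 < n)%N.

Let nR0 : 0 < n%:R :> R. Proof. by rewrite ltr0n. Qed.

Let sum_spinE s : \sum_(i < n) spin R (s i) = n%:R * Q1 R s.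
Proof. by rewrite /Q1 mulrC mulfVK// gt_eqF. Qed.

(* Jensen: Z (h + t) / Z h is the Gibbs average of exp (t n Q1). *)
Lemma pressure_tangent_le h t :
  t * gibbs J tau h h1 (@Q1 R n) <=
  pressure J tau (h + t) h1 - pressure J tau h h1.
Proof.
set m := gibbs J tau h h1 _.
have Zt : expR (t * (n%:R * m)) * Z h <= Z (h + t).
  (* The factor [1 + t n (Q1 - m)] has Gibbs mean 1, and the exponential lies above its tangent line
     at [t n m]. *)
  have -> : expR (t * (n%:R * m)) * Z h = \sum_s (expR (t * (n%:R * m)) *
      (1 + (t * n%:R) * (Q1 R s - m))) * W h s.
    have -> : \sum_s (expR (t * (n%:R * m)) *
        (1 + (t * n%:R) * (Q1 R s - m))) * W h s =
        Z h * E h (fun s => expR (t * (n%:R * m)) *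
          (1 + ((t * n%:R) * Q1 R s + - (t * n%:R * m)))).
      rewrite /E /gibbs [RHS]mulrC mulfVK ?Z_neq0//; apply: eq_bigr => s _.
      by rewrite mulrBr.
    by rewrite /E gibbsZ gibbsD gibbs_cst gibbsD gibbsZ gibbs_cst subrr addr0 mulr1 mulrC.
  apply: ler_sum => s _; rewrite ham_shift expRD [leRHS]mulrC ler_pM2r ?expR_gt0//.
  rewrite sum_spinE.
  have -> : t * (n%:R * Q1 R s) = t * (n%:R * m) + t * n%:R * (Q1 R s - m) by ring.
  by rewrite expRD ler_pM2l ?expR_gt0// expR_ge1Dx.
rewrite /pressure -mulrBl ler_pdivlMr// -mulrA [m * _]mulrC.
rewrite -[leLHS]expRK -lnV ?posrE ?Zpart_gt0// -lnM ?posrE ?invr_gt0 ?Zpart_gt0//.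
by rewrite ler_ln ?posrE ?expR_gt0 ?divr_gt0 ?Zpart_gt0// ler_pdivlMr ?Zpart_gt0.
Qed.

Let is_derive_wsum f h :
  is_derive h (1 : R) (fun x => \sum_s f s * W x s)
    (n%:R * \sum_s (f s * Q1 R s) * W h s).
Proof.
have dW s : is_derive h (1 : R) (fun x => f s * W x s)
    (n%:R * (f s * Q1 R s * W h s)).
  (* Each Boltzmann weight is an exponential in the field with rate [n Q1 s], so differentiation
     only brings down that factor. *)
  have WE : W ^~ s = fun x => W 0 s * expR (x * (n%:R * Q1 R s)).
    apply/funext => x; rewrite /W -{1}[x]add0r ham_shift expRD.
    by rewrite sum_spinE.
  have dx : is_derive h (1 : R) (fun x : R => x * (n%:R * Q1 R s)) (n%:R * Q1 R s).
    have := is_deriveM (is_derive_id h (1 : R)) (is_derive_cst (n%:R * Q1 R s : R) h (1 : R)).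
    by rewrite scaler0 add0r /GRing.scale/= mulr1.
  have de := is_derive1_comp (is_derive_expR _) dx.
  have dd := is_deriveM (is_derive_cst (f s * W 0 s : R) h (1 : R)) de.
  have -> : (fun x => f s * W x s) =
      (fun x => f s * W 0 s * expR (x * (n%:R * Q1 R s))).
    by apply/funext => x; rewrite -mulrA -[_ * expR _](congr1 (@^~ x) WE).
  apply: is_derive_eq dd _; rewrite scaler0 addr0 /GRing.scale/=.
  by rewrite (congr1 (@^~ h) WE); ring.
by rewrite mulr_sumr; exact: is_derive_bigsum.
Qed.

Let is_derive_Z h : is_derive h (1 : R) Z (n%:R * (E h (@Q1 R n) * Z h)).
Proof.
have := is_derive_wsum (fun=> 1) h.
have -> : (fun x => \sum_s 1 * W x s) = Z.
  by apply/funext => x; apply: eq_bigr => s _; rewrite mul1r.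
move=> dZ; apply: is_derive_eq dZ _; congr (_ * _).
rewrite /E /gibbs mulfVK ?Z_neq0//.
by apply: eq_bigr => s _; rewrite mul1r.
Qed.

(** Quotient rule applied to two weighted sums; at [f = Q1] it is the fluctuation relation
    [A' = n V]. *)
Lemma is_derive_gibbs f h :
  is_derive h (1 : R) (fun x => gibbs J tau x h1 f)
    (n%:R * (gibbs J tau h h1 (fun s => f s * Q1 R s)
             - gibbs J tau h h1 f * gibbs J tau h h1 (@Q1 R n))).
Proof.
have := is_deriveM (is_derive_wsum f h) (is_deriveV (Z_neq0 h) (is_derive_Z h)).
move=> dE; apply: is_derive_eq dE _; rewrite /GRing.scale/=.
rewrite /E /gibbs -/(Z h); field; exact: Z_neq0.
Qed.

Lemma is_derive_pressure h :
  is_derive h (1 : R) (fun x => pressure J tau x h1) (gibbs J tau h h1 (@Q1 R n)).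
Proof.
have dl := @is_derive1_comp _ (@ln R) Z h _ _
  (is_derive1_ln (Zpart_gt0 h)) (is_derive_Z h).
have := is_deriveM dl (is_derive_cst (n%:R^-1 : R) h (1 : R)).
move=> dE; apply: is_derive_eq dE _; rewrite scaler0 add0r /GRing.scale/= /E.
rewrite -[Zpart _ _ _ _]/(Z h); set m := gibbs _ _ _ _ _.
by field; rewrite Z_neq0/= gt_eqF.
Qed.

Lemma continuous_gibbs f : continuous (fun x => gibbs J tau x h1 f).
Proof.
move=> h; apply: differentiable_continuous; apply/derivable1_diffP.
have dE := is_derive_gibbs f h; exact: (@ex_derive _ _ _ _ _ _ _ dE).
Qed.

End gibbs_calculus.

(** * Joint measurability in field and disorder *)

Section gibbs_measurability.
Context (R : realType) (n : nat) d (T : measurableType d).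
(** The field is a function on [T], so that one argument covers both a fixed field and the field
    coordinate of a product space. *)
Variables (J : {set 'I_n} -> T -> R) (tau : 'I_n -> T -> R) (h : T -> R) (h1 : R).
Hypothesis mJ : forall X, measurable_fun setT (J X).
Hypothesis mtau : forall i, measurable_fun setT (tau i).
Hypothesis mh : measurable_fun setT h.

Let J_ w X := J X w.
Let tau_ w i := tau i w.

Let measurable_weight s :
  measurable_fun setT (fun w => expR (- hamiltonian (J_ w) (tau_ w) (h w) h1 s)).
Proof.
apply: (measurableT_comp (@measurable_expR R)).
have mc (c : R) : measurable_fun setT (fun _ : T => c) by exact: measurable_cst.
apply: measurable_funN.
apply: measurable_funB; first apply: measurable_funB.
- apply: measurable_funN.
  by apply: measurable_sum => X; apply: measurable_funM; [exact: mJ|exact: mc].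
- by apply: measurable_funM; [exact: mh|exact: mc].
- apply: measurable_funM; first exact: mc.
  by apply: measurable_sum => i; apply: measurable_funM; [exact: mtau|exact: mc].
Qed.

Let measurable_Zpart : measurable_fun setT (fun w => Zpart (J_ w) (tau_ w) (h w) h1).
Proof. by apply: measurable_sum. Qed.

Lemma measurable_pressure :
  measurable_fun setT (fun w => pressure (J ^~ w) (tau ^~ w) (h w) h1).
Proof.
apply: measurable_funM; last exact: measurable_cst.
exact: (measurableT_comp (@measurable_ln R)).
Qed.

Lemma measurable_gibbs f :
  measurable_fun setT (fun w => gibbs (J ^~ w) (tau ^~ w) (h w) h1 f).
Proof.
(* The partition function is positive, so its inverse can be written with [expR] and [ln], both
   measurable. *)
have -> : (fun w => gibbs (J ^~ w) (tau ^~ w) (h w) h1 f) = (fun w =>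
    (\sum_(s : config n) f s * expR (- hamiltonian (J_ w) (tau_ w) (h w) h1 s)) *
    expR (- ln (Zpart (J_ w) (tau_ w) (h w) h1))).
  by apply/funext => w; rewrite expRN lnK// posrE Zpart_gt0.
apply: measurable_funM.
  by apply: measurable_sum => s; apply: measurable_funM => //; exact: measurable_cst.
apply: (measurableT_comp (@measurable_expR R)).
apply: measurable_funN.
exact: (measurableT_comp (@measurable_ln R)).
Qed.

End gibbs_measurability.

(** * Choice of the step and the bound for large systems *)

Lemma eventually_powR_ge (R : realType) (K r : R) : 0 < r ->
  exists N : nat, forall n : nat, (N <= n)%N -> K <= n%:R `^ r.
Proof.
move=> r0; exists (Num.trunc (`|K| `^ r^-1)).+1 => n Kn.
have Kn' : `|K| `^ r^-1 <= n%:R.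
  by rewrite (le_trans (ltW (truncnS_gt _)))// ler_nat.
apply: le_trans (ler_norm K) _.
have -> : `|K| = (`|K| `^ r^-1) `^ r.
  by rewrite -powRrM mulVf ?gt_eqF// powRr1.
by apply: ge0_ler_powR; rewrite ?nnegrE ?powR_ge0//; exact: ltW.
Qed.

Theorem theorem2p2 (R : realType) (theta hlo hhi h1 alpha C CP : R)
  (d : nat -> measure_display) (Omega : forall n, measurableType (d n))
  (P : forall n, probability (Omega n) R)
  (J : forall n, {set 'I_n} -> Omega n -> R)
  (tau : forall n, R -> 'I_n -> Omega n -> R) :
  1 / 2 < theta -> theta <= 7 / 8 ->
  0 < hlo -> hlo <= hhi -> hhi < 1 ->
  0 <= h1 <= 1 -> 0 <= alpha <= 1 -> 0 < CP ->
  (* couplings: nonnegative, measurable, finite second moments *)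
  (forall n X w, 0 <= J n X w) ->
  (forall n X, measurable_fun setT (J n X)) ->
  (forall n X, (P n).-integrable setT (fun w => ((J n X w) ^+ 2)%:E)) ->
  (forall n, \sum_(X : {set 'I_n}) var_real (P n) (J n X) <= C * n%:R) ->
  (* tau^a_i i.i.d. Poisson with mean a n^(theta-1), for each a in [0,1] *)
  (forall n a i, 0 <= a <= 1 -> measurable_fun setT (tau n a i)) ->
  (forall n a i k, 0 <= a <= 1 ->
     P n (tau n a i @^-1` [set k%:R]) =
     (poissonP (a * n%:R `^ (theta - 1)) k)%:E) ->
  (* all couplings and all tau_i jointly independent *)
  (forall n a, 0 <= a <= 1 ->
     mutually_independent (P n)
       (fun k : {set 'I_n} + 'I_n =>
          match k with inl X => J n X | inr i => tau n a i end)) ->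
  (* nonnegative truncated two-point functions, for every realization *)
  (forall n w h0, hlo <= h0 <= hhi -> forall i j : 'I_n,
     0 <= gibbs (fun X => J n X w) (fun k => tau n alpha k w) h0 h1
            (fun s => spin R (s i) * spin R (s j))
        - gibbs (fun X => J n X w) (fun k => tau n alpha k w) h0 h1
            (fun s => spin R (s i))
          * gibbs (fun X => J n X w) (fun k => tau n alpha k w) h0 h1
            (fun s => spin R (s j))) ->
  (* concentration of the pressure *)
  (forall n h0 h1' a, 0 <= h0 <= 1 -> 0 <= h1' <= 1 -> 0 <= a <= 1 ->
     (\int[P n]_w
        ((pressure (fun X => J n X w) (fun k => tau n a k w) h0 h1'
          - Rintegral (P n) setT
              (fun w' => pressure (fun X => J n X w') (fun k => tau n a k w') h0 h1'))
         ^+ 2)%:E <= (CP / n%:R)%:E)%E) ->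
  exists N : nat, forall n : nat, (N <= n)%N ->
    (\int[lebesgue_measure]_(h0 in `[hlo, hhi]%classic)
       (\int[P n]_w
          (gibbs (fun X => J n X w) (fun k => tau n alpha k w) h0 h1
             (fun s => (Q1 R s -
                Rintegral (P n) setT
                  (fun w' => gibbs (fun X => J n X w') (fun k => tau n alpha k w')
                               h0 h1 (@Q1 R n))) ^+ 2))%:E)
     <= ((5 * CP + 42) / n%:R `^ (1 / 3))%:E)%E.

Proof.
move=> _ _ hlo0 hlohi hhi1 h101 alpha01 CP0 _ mJ _ _ mtau _ _ _ conc.
have third0 : 0 < 1 / 3 :> R by rewrite divr_gt0.
(* This threshold makes [e = 2 / r] at most [hlo] and at most [1 - hhi], so the shifted fields stay
   in [0, 1]; the successor below excludes [n = 0]. *)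
have [M HM] := eventually_powR_ge (2 / hlo + 2 / (1 - hhi)) third0.
exists M.+1 => n Mn.
have n0 : (0 < n)%N by exact: leq_trans Mn.
have nR0 : 0 < n%:R :> R by rewrite ltr0n.
set r : R := n%:R `^ (1 / 3).
have r0 : 0 < r by rewrite powR_gt0.
have r3 : r ^+ 3 = n%:R.
  by rewrite -powR_mulrn ?ltW// -powRrM divfK ?pnatr_eq0// powRr1// ltW.
have hhi0 : 0 < 1 - hhi by rewrite subr_gt0.
have rK : 2 / hlo + 2 / (1 - hhi) <= r by apply: HM; exact: ltnW.
have rlo : 2 / hlo <= r by rewrite (le_trans _ rK)// lerDl divr_ge0// ltW.
have rhi : 2 / (1 - hhi) <= r by rewrite (le_trans _ rK)// lerDr divr_ge0// ltW.
have r1 : 1 <= r.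
  by apply: le_trans rlo; rewrite ler_pdivlMr// mul1r; lra.
(* With [n = r^3] this step gives the concentration term [16 CP / (n e^2)] and the boundary term
   [16 e] the same order [1 / r]. *)
pose e := 2 / r.
have e0 : 0 < e by rewrite divr_gt0.
have elo : e <= hlo by rewrite ler_pdivrMr// mulrC -ler_pdivrMr.
have ehi : e <= 1 - hhi by rewrite ler_pdivrMr// mulrC -ler_pdivrMr.
pose E h w f := gibbs (fun X => J n X w) (fun k => tau n alpha k w) h h1 f.
pose L h w := pressure (fun X => J n X w) (fun k => tau n alpha k w) h h1.
pose A h w := E h w (@Q1 R n).
pose V h w := E h w (fun s => Q1 R s ^+ 2) - A h w ^+ 2.
have mE f : measurable_fun setT (fun z : R * Omega n => E z.1 z.2 f).
  apply: (@measurable_gibbs R n _ _ (fun X z => J n X z.2)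
    (fun i z => tau n alpha i z.2) (fun z => z.1)) => [X|i|].
  - exact: (measurableT_comp (mJ n X) measurable_snd).
  - exact: (measurableT_comp (mtau n alpha i alpha01) measurable_snd).
  - exact: measurable_fst.
have mL h : measurable_fun setT (L h).
  apply: (@measurable_pressure R n _ _ (J n) (tau n alpha) (fun=> h)) => //.
  by move=> i; exact: mtau.
have mV : measurable_fun setT (fun z : R * Omega n => V z.1 z.2).
  exact: (measurable_funB (mE _) (measurable_funX 2 (mE _))).
have dA h w : is_derive h (1 : R) (A ^~ w) (n%:R * V h w).
  have dE := is_derive_gibbs (fun X => J n X w) (fun k => tau n alpha k w) h1 n0
    (@Q1 R n) h.
  (* The square in [V] unfolds to the products in the derivative, so the two agree by conversion. *)
  exact: dE.
have cV w : continuous (V ^~ w).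
  have cE f : continuous (fun h => E h w f) by exact: continuous_gibbs.
  move=> h.
  exact: (continuousB (cE _ h) (continuousM (cE _ h) (cE _ h))).
have := @integral_fluctuation_le R _ _ (P n) L A V n%:R CP nR0 CP0 mL (mE _) mV
  (fun h w => gibbs_Q1_abs _ _ h1 h) (fun h w => gibbs_variance_ge0 _ _ h1 h _)
  (fun h t w => pressure_tangent_le _ _ h1 n0 h t)
  (fun h w => is_derive_pressure _ _ h1 n0 h) dA cV
  (fun h h01 => conc n h h1 alpha h01 h101 alpha01) hlo hhi e e0.
have ae : 0 <= hlo - e by rewrite subr_ge0.
have be : hhi + e <= 1 by lra.
move=> /(_ ae hlohi be) Hint.
under eq_integral => h _ do under eq_integral => w _ do rewrite gibbs_sqrB.
apply: le_trans Hint _; rewrite lee_fin -r3 /e.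
have -> : 16 * CP / (r ^+ 3 * (2 / r) ^+ 2) = 4 * CP / r by field; rewrite gt_eqF.
have -> : 16 * (2 / r) = 32 / r by ring.
(* As [r >= 1], the term [2 / n] is also of order [1 / r]; the total is at most [(4 CP + 34) / r],
   within the claimed constant. *)
have : 2 / r ^+ 3 <= 2 / r.
  by rewrite ler_pM2l// lef_pV2 ?posrE ?exprn_gt0// ler_eXnr.
have : 0 <= CP / r by rewrite divr_ge0// ltW.
have : 0 <= r^-1 by rewrite invr_ge0 ltW.
lra.
Qed.
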